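(* Let $\mathbf{a}_1,\ldots,\mathbf{a}_m\in\mathbb{C}^d$ and $\mathcal{A}(X)=(\mathbf{a}_1^*X\mathbf{a}_1,\ldots,\mathbf{a}_m^*X\mathbf{a}_m)$. Let $a\ge 1$ and assume that $\mathcal{A}$ satisfies the restricted isometry property of order $(2,2ak)$ with constants $c,C>0$, where $$c-\frac{4\sqrt2\,C}{\sqrt a}-\frac{C}{a}>0 .$$ Set $$\alpha:=\frac{1+\frac1a+\frac{4\sqrt2}{\sqrt a}}{c-\frac{C}{a}-\frac{4\sqrt2\,C}{\sqrt a}} .$$ Let $\mu>0$. Then for any $k$-sparse $\mathbf{x}_0\in\mathbb{C}^d$ and $\mathbf{w}\in\mathbb{R}^m$, with $\mathbf{b}=\mathcal{A}(\mathbf{x}_0\mathbf{x}_0^* )+\mathbf{w}$, any solution $X^\#=\mathbf{x}^\#(\mathbf{x}^\#)^*$ of $$\min_{X\in\mathbb{C}^{d\times d}}\ \mu\|X\|_1+\frac12\|\mathcal{A}(X)-\mathbf{b}\|_2^2\quad\text{s.t.}\quad X\succeq 0,\ \mathrm{rank}(X)=1$$ satisfies $$\|\mathbf{x}^\#(\mathbf{x}^\#)^*-\mathbf{x}_0\mathbf{x}_0^*\|_F\le(2C\alpha+2)\frac{\|\mathbf{w}\|_2}{\sqrt{\mu ak}}\left(\|\mathbf{x}_0\|_1+\frac{\|\mathbf{w}\|_2}{\sqrt\mu}\right)+\frac{\|\mathbf{w}\|_2^2}{2\mu ak}+\alpha\cdot\frac{\mu ak}{2C}\left(\frac{C\|\mathbf{w}\|_2}{\mu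 ak}+\frac1{\sqrt m}\right)^2 .$$
   Context: For $X\in\mathbb{C}^{d\times d}$: $\|X\|_1=\sum_{i,j}|X_{i,j}|$ is the entrywise $\ell_1$ norm, $\|X\|_F$ is the Frobenius norm, $\|X\|_{0,2}$ is the number of nonzero columns of $X$, and $X\succeq0$ means Hermitian positive semidefinite. $\mathbf{x}_0$ is $k$-sparse if it has at most $k$ nonzero entries. $\mathbb{H}^{d\times d}$ denotes the set of $d\times d$ Hermitian matrices; $\mathcal{A}$ maps $\mathbb{H}^{d\times d}$ to $\mathbb{R}^m$. The map $\mathcal{A}:\mathbb{H}^{d\times d}\to\mathbb{R}^m$ satisfies the restricted isometry property (RIP) of order $(r,s)$ with constants $c,C>0$ if $$c\|X\|_F\le\frac1m\|\mathcal{A}(X)\|_1\le C\|X\|_F$$ for all $X\in\mathbb{H}^{d\times d}$ with $\mathrm{rank}(X)\le r$ and $\|X\|_{0,2}\le s$ (here $\|\mathcal{A}(X)\|_1$ is the vector $\ell_1$ norm). *)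

(* Defs.v *)
From HB Require Import structures.
From mathcomp Require Import all_boot all_order all_algebra.
From mathcomp Require Import reals.
From mathcomp Require Import complex.
Set Implicit Arguments.
Unset Strict Implicit.
Unset Printing Implicit Defensive.
Import Order.TTheory GRing.Theory Num.Theory.
Import ComplexField.
Local Open Scope ring_scope.
Local Open Scope sesquilinear_scope.

Section Norms.
Variable R : realType.

(* [Normc.normc] is the R-valued modulus; the library's [`|z|] lives in R[i]. *)
Definition norm1 m n (X : 'M[R[i]]_(m, n)) : R :=
  \sum_i \sum_j Normc.normc (X i j).

Definition normF m n (X : 'M[R[i]]_(m, n)) : R :=
  Num.sqrt (\sum_i \sum_j Normc.normc (X i j) ^+ 2).

Definition norm02 m n (X : 'M[R[i]]_(m, n)) : nat :=
  #|[set j | col j X != 0]|.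

Definition sparse d (k : nat) (x : 'cV[R[i]]_d) : Prop :=
  (#|[set i | x i ord0 != 0%R]| <= k)%N.

Definition rnorm1 m (v : 'cV[R]_m) : R := \sum_i `|v i ord0|.

Definition rnorm2 m (v : 'cV[R]_m) : R := Num.sqrt (\sum_i v i ord0 ^+ 2).

End Norms.

Section Measurements.
Variable R : realType.

Definition psd d (X : 'M[R[i]]_d) : Prop :=
  X \is hermsymmx /\ forall x : 'cV[R[i]]_d, 0 <= (x ^t* *m X *m x) ord0 ord0.

(* The quadratic form is real on Hermitian matrices (see [quad_measE]), so
   taking the real part only fixes the codomain; values on non-Hermitian
   matrices are irrelevant. *)
Definition quad_meas d m (av : 'I_m -> 'cV[R[i]]_d) (X : 'M[R[i]]_d)
    : 'cV[R]_m :=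
  \col_i complex.Re (((av i) ^t* *m X *m av i) ord0 ord0).

Lemma quad_measE d m (av : 'I_m -> 'cV[R[i]]_d) (X : 'M[R[i]]_d) i :
  X \is hermsymmx ->
  real_complex R (quad_meas av X i ord0) =
    ((av i) ^t* *m X *m av i) ord0 ord0.
Proof.
move=> /is_hermitianmxP; rewrite expr0 scale1r => hX.
rewrite mxE; set q := (X in complex.Re X).
suff qR : q \is Num.real by exact: RRe_real.
rewrite CrealE; apply/eqP; rewrite /q.
transitivity ((((av i) ^t* *m X *m av i) ^t*) ord0 ord0); first by rewrite !mxE.
rewrite !trmx_mul !map_mxM /= -hX -map_trmx trmxK mulmxA.
have -> // : map_mx Num.conj (map_mx Num.conj (av i)) = av i.
by apply/matrixP => p r; rewrite !mxE conjCK.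
Qed.

(* The bound [s] on the number of nonzero columns is a real number, since it is
   instantiated with [2 * a * k] for real [a]. *)
Definition RIP d m (A : 'M[R[i]]_d -> 'cV[R]_m) (r : nat) (s c C : R) : Prop :=
  [/\ 0 < c, 0 < C &
      forall X : 'M[R[i]]_d, X \is hermsymmx ->
        (\rank X <= r)%N -> (norm02 X)%:R <= s ->
        c * normF X <= m%:R^-1 * rnorm1 (A X) /\
        m%:R^-1 * rnorm1 (A X) <= C * normF X].

Definition is_minimizer T (feasible : T -> Prop) (f : T -> R) (x : T) : Prop :=
  feasible x /\ forall y, feasible y -> f x <= f y.

Definition outer d (x : 'cV[R[i]]_d) : 'M[R[i]]_d := x *m x ^t*.

End Measurements.

(* Main.v *)
(* Write v' for the adjoint of v.  Multiplying x0 by a unit scalar makes <x#, x0>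
   nonnegative without changing x0 x0'.  Let S be the support of x0, T the
   s = floor(a k) largest entries of x# off S, u the restriction of x# to S and T,
   z = x# - u and H = u u' - x0 x0'.  Then x# x#' - x0 x0' = H + (u z' + z u') + z z',
   and z is a sum of s-sparse vectors y_j with L := sum |y_j|_2 <= |x# off S|_1 / sqrt s.
   RIP, applied from below to H and from above to the rank-two pieces made of the
   y_j, gives c |H|_F <= |A(x# x#' - x0 x0')|_1 / m + 2 C |u| L + C L^2.
   Minimality bounds |x#|_1^2 - |x0|_1^2 by the noise.  Hence, up to noise,
   |x# off S|_1 is at most sqrt k |u - x0| and its square is at most k |H|_F, while
   the alignment gives |u| |u - x0| <= sqrt 2 |H|_F.  The residual
   t = |A(x# x#' - x0 x0')|_2 is eliminated by maximizing a concave quadratic in t. *)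
Require Import Defs.
From mathcomp Require Import all_boot all_order all_algebra.
From mathcomp Require Import reals.
From mathcomp Require Import complex.
From mathcomp Require Import ring lra.
Import Order.TTheory GRing.Theory Num.Theory.
Local Open Scope ring_scope.
Local Open Scope sesquilinear_scope.

Set Implicit Arguments.
Unset Strict Implicit.
Unset Printing Implicit Defensive.

(** * Euclidean norms of finite real families *)

Section EuclideanNorm.
Variables (R : rcfType) (I : finType).
Implicit Types f g : I -> R.

Definition l2norm f : R := Num.sqrt (\sum_i f i ^+ 2).

Lemma l2norm_ge0 f : 0 <= l2norm f. Proof. exact: sqrtr_ge0. Qed.

Lemma sqr_l2norm f : l2norm f ^+ 2 = \sum_i f i ^+ 2.
Proof. by rewrite sqr_sqrtr// sumr_ge0// => i _; exact: sqr_ge0. Qed.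

Lemma cauchy_schwarz_sum f g : \sum_i f i * g i <= l2norm f * l2norm g.
Proof.
have [lt0|ge0] := ltP (\sum_i f i * g i) 0.
  by rewrite (le_trans (ltW lt0))// mulr_ge0// l2norm_ge0.
rewrite -(ler_sqr (x := \sum_i _)) ?nnegrE ?mulr_ge0 ?l2norm_ge0// exprMn !sqr_l2norm.
rewrite -subr_ge0.
(* Lagrange's identity: the Cauchy-Schwarz defect is half the sum of the squared 2 by 2 minors
   [D i j]. *)
pose D i j := f i * g j - f j * g i.
have -> : (\sum_i f i ^+ 2) * (\sum_i g i ^+ 2) - (\sum_i f i * g i) ^+ 2 =
    2^-1 * \sum_i \sum_j D i j ^+ 2.
  have ->: \sum_i \sum_j D i j ^+ 2 = \sum_i \sum_j (f i ^+ 2 * g j ^+ 2)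
      + \sum_i \sum_j (g i ^+ 2 * f j ^+ 2)
      - 2 * \sum_i \sum_j ((f i * g i) * (f j * g j)).
    rewrite mulr_sumr -big_split -sumrB /=; apply: eq_bigr => i _.
    rewrite mulr_sumr -big_split -sumrB /=; apply: eq_bigr => j _.
    by rewrite /D; ring.
  rewrite -!big_distrlr /= expr2.
  set x := \sum_i f i ^+ 2; set y := \sum_i g i ^+ 2; set z := \sum_i f i * g i.
  by field.
by rewrite mulr_ge0 ?invr_ge0// sumr_ge0// => i _; rewrite sumr_ge0// => j _; exact: sqr_ge0.
Qed.

Lemma ler_l2norm f g : (forall i, 0 <= f i <= g i) -> l2norm f <= l2norm g.
Proof.
move=> fg; apply/ler_wsqrtr/ler_sum => i _; have /andP[f0 fgi] := fg i.
by rewrite lerXn2r// nnegrE (le_trans f0).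
Qed.

Lemma l2normD f g : l2norm (fun i => f i + g i) <= l2norm f + l2norm g.
Proof.
rewrite -(@ler_pXn2r _ 2)// ?nnegrE ?addr_ge0 ?l2norm_ge0//.
rewrite sqr_l2norm sqrrD !sqr_l2norm.
under eq_bigr do rewrite sqrrD.
by rewrite !big_split /= lerD2r lerD2l mulr2n lerD// cauchy_schwarz_sum.
Qed.

(** Cauchy-Schwarz against the indicator of [A]; this is the source of the factors [sqrt k], [k] and
    [1 / sqrt m] later on. *)
Lemma sum_le_l2norm (A : {set I}) f :
  \sum_(i in A) f i <= Num.sqrt #|A|%:R * l2norm f.
Proof.
have -> : Num.sqrt #|A|%:R = l2norm (fun i => (i \in A)%:R).
  rewrite /l2norm -sum1_card natr_sum big_mkcond; congr Num.sqrt.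
  by apply: eq_bigr => i _; case: (_ \in _); rewrite ?expr1n ?expr0n.
apply: le_trans (cauchy_schwarz_sum _ _); rewrite big_mkcond.
by apply: ler_sum => i _; case: (_ \in _); rewrite ?mul1r ?mul0r.
Qed.

Lemma l2norm_le_sum f : (forall i, 0 <= f i) -> l2norm f <= \sum_i f i.
Proof.
move=> f0; have sf0 : 0 <= \sum_i f i by exact: sumr_ge0.
rewrite -(@ler_pXn2r _ 2)// ?nnegrE ?l2norm_ge0// sqr_l2norm expr2 big_distrlr /=.
apply: ler_sum => i _; rewrite (bigD1 i)//= -expr2 lerDl.
by rewrite sumr_ge0// => j _; rewrite mulr_ge0.
Qed.

End EuclideanNorm.

(** * Frobenius norms and rank-one products over the complex numbers *)

Section ComplexMatrices.
Variable R : realType.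
Local Notation normc := (@Normc.normc R).

Lemma normc_ge0 (z : R[i]) : 0 <= normc z.
Proof. by case: z => a b; exact: sqrtr_ge0. Qed.

Lemma sqr_normcE (z : R[i]) : normc z ^+ 2 = complex.Re z ^+ 2 + complex.Im z ^+ 2.
Proof. by case: z => a b; rewrite /= sqr_sqrtr// addr_ge0 ?sqr_ge0. Qed.

Lemma conjCE (z : R[i]) : (Num.conj z : R[i]) = (complex.Re z -i* complex.Im z)%C.
Proof. by case: z. Qed.

Lemma normc_conj (z : R[i]) : normc (Num.conj z) = normc z.
Proof. by rewrite conjCE; case: z => a b /=; rewrite sqrrN. Qed.

Lemma ler_normcD (x y : R[i]) : normc (x + y) <= normc x + normc y.
Proof. exact: (@le_normcD R x y). Qed.

Lemma normc_eq0 (z : R[i]) : (normc z == 0) = (z == 0).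
Proof.
by apply/eqP/eqP => [/Normc.eq0_normc//|->]; exact: Normc.normc0.
Qed.

Lemma normFE m n (X : 'M[R[i]]_(m, n)) :
  normF X = l2norm (fun p : 'I_m * 'I_n => normc (X p.1 p.2)).
Proof. by rewrite /normF /l2norm pair_bigA. Qed.

Lemma normF_colE n (v : 'cV[R[i]]_n) : normF v = l2norm (fun i => normc (v i ord0)).
Proof. by congr Num.sqrt; apply: eq_bigr => i _; rewrite big_ord1. Qed.

Lemma norm1_colE n (v : 'cV[R[i]]_n) : norm1 v = \sum_i normc (v i ord0).
Proof. by apply: eq_bigr => i _; rewrite big_ord1. Qed.

Lemma normF_ge0 m n (X : 'M[R[i]]_(m, n)) : 0 <= normF X.
Proof. exact: sqrtr_ge0. Qed.

Lemma norm1_ge0 m n (X : 'M[R[i]]_(m, n)) : 0 <= norm1 X.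
Proof. by rewrite sumr_ge0// => i _; rewrite sumr_ge0// => j _; exact: normc_ge0. Qed.

Lemma ler_normFD m n (X Y : 'M[R[i]]_(m, n)) : normF (X + Y) <= normF X + normF Y.
Proof.
rewrite !normFE; apply: le_trans (l2normD _ _); apply: ler_l2norm => p.
by rewrite normc_ge0 mxE ler_normcD.
Qed.

Lemma normF_le_norm1 n (v : 'cV[R[i]]_n) : normF v <= norm1 v.
Proof.
by rewrite normF_colE norm1_colE l2norm_le_sum// => i; exact: normc_ge0.
Qed.

Lemma mul_col_adjE n (u v : 'cV[R[i]]_n) i j :
  (u *m v ^t*) i j = u i ord0 * Num.conj (v j ord0).
Proof. by rewrite mxE big_ord1 !mxE. Qed.

Lemma normF_mul_col_adj n (u v : 'cV[R[i]]_n) : normF (u *m v ^t*) = normF u * normF v.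
Proof.
rewrite !normF_colE /l2norm -sqrtrM ?sumr_ge0// => [|i _]; last exact: sqr_ge0.
congr Num.sqrt; rewrite big_distrlr /=; apply: eq_bigr => i _; apply: eq_bigr => j _.
by rewrite mul_col_adjE Normc.normcM normc_conj exprMn.
Qed.

Lemma normF_outer n (v : 'cV[R[i]]_n) : normF (outer v) = normF v ^+ 2.
Proof. exact: normF_mul_col_adj. Qed.

Lemma norm1_outer n (v : 'cV[R[i]]_n) : norm1 (outer v) = norm1 v ^+ 2.
Proof.
rewrite !norm1_colE expr2 big_distrlr /=; apply: eq_bigr => i _; apply: eq_bigr => j _.
by rewrite mul_col_adjE Normc.normcM normc_conj.
Qed.

Definition sym_outer n (u v : 'cV[R[i]]_n) : 'M[R[i]]_n := u *m v ^t* + v *m u ^t*.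

Lemma adjmxD m n (X Y : 'M[R[i]]_(m, n)) : (X + Y) ^t* = X ^t* + Y ^t*.
Proof. by rewrite linearD /= map_mxD. Qed.

Lemma adjmxM m n p (X : 'M[R[i]]_(m, n)) (Y : 'M[R[i]]_(n, p)) :
  (X *m Y) ^t* = Y ^t* *m X ^t*.
Proof. by rewrite trmx_mul map_mxM. Qed.

Lemma adjmxK m n (X : 'M[R[i]]_(m, n)) : (X ^t*) ^t* = X.
Proof. by apply/matrixP => i j; rewrite !mxE conjCK. Qed.

Lemma outerD n (u v : 'cV[R[i]]_n) : outer (u + v) = outer u + outer v + sym_outer u v.
Proof.
rewrite /outer /sym_outer adjmxD mulmxDl !mulmxDr -!addrA; congr (_ + _).
by rewrite [RHS]addrCA; congr (_ + _); rewrite addrC.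
Qed.

Lemma sym_outerDr n (u v w : 'cV[R[i]]_n) :
  sym_outer u (v + w) = sym_outer u v + sym_outer u w.
Proof. by rewrite /sym_outer adjmxD mulmxDl mulmxDr addrACA. Qed.

Lemma sym_outerC n (u v : 'cV[R[i]]_n) : sym_outer u v = sym_outer v u.
Proof. exact: addrC. Qed.

Lemma outer0 n : outer (0 : 'cV[R[i]]_n) = 0.
Proof. exact: mul0mx. Qed.

Lemma sym_outer0 n (u : 'cV[R[i]]_n) : sym_outer u 0 = 0.
Proof.
by rewrite /sym_outer mul0mx addr0 trmx0 map_mx0 mulmx0.
Qed.

Lemma normF_sym_outer_le n (u v : 'cV[R[i]]_n) :
  normF (sym_outer u v) <= 2 * (normF u * normF v).
Proof.
apply: le_trans (ler_normFD _ _) _.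
by rewrite !normF_mul_col_adj [X in _ + X]mulrC mulr_natl mulr2n.
Qed.

(** At every entry at least one of [u v'] and [v u'] vanishes, because [u] or [v] is zero at the row
    index. Squared moduli therefore add, and the factor 2 of the triangle inequality drops to
    [sqrt 2]. *)
Lemma normF_sym_outer_orth n (u v : 'cV[R[i]]_n) :
  (forall i, u i ord0 * v i ord0 = 0) ->
  normF (sym_outer u v) = Num.sqrt 2 * (normF u * normF v).
Proof.
move=> uv0; rewrite !normF_colE /l2norm -!sqrtrM ?sumr_ge0// => [|i _]; last exact: sqr_ge0.
congr Num.sqrt.
set u2 := \sum_i normc (u i ord0) ^+ 2; set v2 := \sum_i normc (v i ord0) ^+ 2.
have ->: 2 * (u2 * v2) = u2 * v2 + v2 * u2 by ring.
rewrite !big_distrlr /= -big_split /=; apply: eq_bigr => i _.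
rewrite -big_split /=; apply: eq_bigr => j _.
rewrite mxE !mul_col_adjE -!exprMn -(normc_conj (v j _)) -(normc_conj (u j _)) -!Normc.normcM.
have /eqP := uv0 i; rewrite mulf_eq0 => /orP[]/eqP->.
  by rewrite !mul0r add0r Normc.normc0 expr0n add0r.
by rewrite !mul0r addr0 Normc.normc0 expr0n addr0.
Qed.

(* With <u,v> real and nonnegative the left-hand side expands to
   p^4 + q^4 - 2 r^2, where p = |u|, q = |v| and r = <u,v> <= p q. *)
Lemma normF_sub_outer n (u v : 'cV[R[i]]_n) :
  0 <= complex.Re (\sum_i u i ord0 * Num.conj (v i ord0)) ->
  complex.Im (\sum_i u i ord0 * Num.conj (v i ord0)) = 0 ->
  normF u * normF (u - v) <= Num.sqrt 2 * normF (outer u - outer v).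
Proof.
have Re_sum (F : 'I_n -> R[i]) : complex.Re (\sum_i F i) = \sum_i complex.Re (F i).
  by apply: (big_morph (@complex.Re R)) => // -[a b] [a' b'].
have Im_sum (F : 'I_n -> R[i]) : complex.Im (\sum_i F i) = \sum_i complex.Im (F i).
  by apply: (big_morph (@complex.Im R)) => // -[a b] [a' b'].
rewrite Re_sum Im_sum; set r := \sum_i _ => r0 im0.
set p := normF u; set q := normF v.
have sq (x : 'cV[R[i]]_n) : normF x ^+ 2 = \sum_i normc (x i ord0) ^+ 2.
  by rewrite normF_colE sqr_l2norm.
have Hd : normF (u - v) ^+ 2 = p ^+ 2 + q ^+ 2 - 2 * r.
  rewrite !sq mulr_sumr -big_split -sumrB /=; apply: eq_bigr => i _.
  rewrite !sqr_normcE !mxE; case: (u i ord0) => a b; case: (v i ord0) => a' b' /=.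
  by ring.
have HO : normF (outer u - outer v) ^+ 2 = p ^+ 4 + q ^+ 4 - 2 * r ^+ 2.
  rewrite normFE sqr_l2norm -(pair_bigA _ (fun i j => normc ((outer u - outer v) i j) ^+ 2)) /=.
  (* Adding the vanishing square of the imaginary part completes [r ^+ 2] to the squared modulus of
     [<u,v>], so the identity can be checked entry by entry. *)
  have -> : p ^+ 4 + q ^+ 4 - 2 * r ^+ 2 = p ^+ 2 * p ^+ 2 + q ^+ 2 * q ^+ 2
      - 2 * (r * r + (\sum_i complex.Im (u i ord0 * Num.conj (v i ord0))) *
       (\sum_i complex.Im (u i ord0 * Num.conj (v i ord0)))) by rewrite im0; ring.
  rewrite !sq !big_distrlr /= -!big_split /= mulr_sumr -sumrB; apply: eq_bigr => i _.
  rewrite -!big_split /= mulr_sumr -sumrB; apply: eq_bigr => j _.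
  rewrite !mxE !big_ord1 !mxE !sqr_normcE.
  case: (u i ord0) => a b; case: (v i ord0) => a' b' /=.
  case: (u j ord0) => c d; case: (v j ord0) => c' d' /=.
  by ring.
have p0 : 0 <= p by exact: normF_ge0.
have q0 : 0 <= q by exact: normF_ge0.
have rpq : r <= p * q.
  rewrite /p /q !normF_colE; apply: le_trans (cauchy_schwarz_sum _ _).
  apply: ler_sum => i _; rewrite -(normc_conj (v i _)) -Normc.normcM.
  case: (_ * _) => a b /=; apply: le_trans (ler_norm _) _.
  by rewrite -sqrtr_sqr ler_wsqrtr// lerDl sqr_ge0.
rewrite -(@ler_pXn2r _ 2)// ?nnegrE ?mulr_ge0 ?normF_ge0 ?sqrtr_ge0//.
rewrite !exprMn [Num.sqrt 2 ^+ 2]sqr_sqrtr// Hd HO.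
rewrite -subr_ge0.
(* The difference of the two sides is a concave quadratic in [r] on [[0, p q]]; [H0] and [H1] are
   its values at the two ends, and [H2] expresses the concavity. The case split is on the sign of
   the slope of the chord-like linear remainder. *)
have H0 : 0 <= p ^+ 4 + 2 * q ^+ 4 - p ^+ 2 * q ^+ 2 by nra.
have H1 : 0 <= (p - q) ^+ 2 * (p ^+ 2 + 4 * (p * q) + 2 * q ^+ 2).
  by rewrite mulr_ge0 ?sqr_ge0 ?addr_ge0 ?mulr_ge0 ?exprn_ge0.
have H2 : 0 <= 4 * r * (p * q - r) by rewrite !mulr_ge0 ?subr_ge0.
have [ge0|lt0] := leP 0 (2 * p ^+ 2 - 4 * (p * q)).
  by have := mulr_ge0 r0 ge0; lra.
have : 0 <= (p * q - r) * (4 * (p * q) - 2 * p ^+ 2).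
  by rewrite mulr_ge0 ?subr_ge0//; lra.
by lra.
Qed.
End ComplexMatrices.

(** * Selection of the largest entries *)

Section LargestEntries.
Variables (R : realFieldType) (I : finType).

Lemma exists_largest (f : I -> R) (s : nat) (A : {set I}) : (s <= #|A|)%N ->
  exists T : {set I}, [/\ T \subset A, #|T| = s &
    forall i j, i \in T -> j \in A :\: T -> f j <= f i].
Proof.
elim: s => [|s IH] sA.
  by exists set0; rewrite sub0set cards0; split=> // i j; rewrite inE.
have [T [TA cT top]] := IH (ltnW sA).
have [i0 i0AT] : exists i0, i0 \in A :\: T.
  by apply/set0Pn; rewrite -card_gt0 cardsD (setIidPr TA) cT subn_gt0.
case: (@Order.TotalTheory.arg_maxP _ R _ i0 (fun i => i \in A :\: T) f i0AT) => i iAT maxi.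
exists (i |: T); split=> [||i' j].
- by rewrite subUset sub1set TA andbT; move: iAT; rewrite inE => /andP[].
- by rewrite cardsU1 cT; move: iAT; rewrite inE => /andP[-> _].
rewrite !inE negb_or => ii' /andP[/andP[ji jT] jA].
have jAT : j \in A :\: T by rewrite inE jT.
by case/orP: ii' => [/eqP->|i'T]; [exact: maxi|exact: top].
Qed.

(** Lifts the condition [s <= #|A|]: a smaller [A] is taken whole, which leaves no [j] to check.
    Otherwise each remaining value lies below all [s] selected ones, hence below their mean. *)
Lemma exists_largest_sum (f : I -> R) (s : nat) (A : {set I}) :
  exists T : {set I}, [/\ T \subset A, (#|T| <= s)%N &
    forall j, j \in A :\: T -> s%:R * f j <= \sum_(i in T) f i].
Proof.
have [sA|As] := leqP s #|A|; last first.
  by exists A; split=> // [|j]; [exact: ltnW|rewrite setDv inE].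
have [T [TA cT top]] := exists_largest f sA; exists T; split=> [//||j jAT].
  by rewrite cT.
rewrite -cT mulr_natl -sumr_const; apply: ler_sum => i iT; exact: top.
Qed.

End LargestEntries.

(** * Restriction to coordinate sets and splitting into sparse blocks *)

Section Restriction.
Variables (R : realType) (d : nat).
Implicit Types (x v : 'cV[R[i]]_d) (T : {set 'I_d}).
Local Notation normc := (@Normc.normc R).

Definition supp v : {set 'I_d} := [set i | v i ord0 != 0].

Definition restr T v : 'cV[R[i]]_d := \col_i (if i \in T then v i ord0 else 0).

Lemma restrE T v i : restr T v i ord0 = if i \in T then v i ord0 else 0.
Proof. by rewrite mxE. Qed.

Lemma supp_restr T v : supp (restr T v) = supp v :&: T.
Proof.
by apply/setP => i; rewrite !inE restrE; case: (i \in T); rewrite ?andbT// eqxx andbF.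
Qed.

Lemma restrU T1 T2 v : [disjoint T1 & T2] ->
  restr (T1 :|: T2) v = restr T1 v + restr T2 v.
Proof.
move=> T12; apply/matrixP => i j; rewrite (ord1 j) !mxE inE.
have [i1|] := boolP (i \in T1); last by rewrite add0r.
by rewrite (disjointFr T12 i1) addr0.
Qed.

Lemma restrC T v : v = restr T v + restr (~: T) v.
Proof.
apply/matrixP => i j; rewrite (ord1 j) !mxE inE.
by case: (i \in T); rewrite ?addr0 ?add0r.
Qed.

Lemma norm1_restr T v : norm1 (restr T v) = \sum_(i in T) normc (v i ord0).
Proof.
rewrite norm1_colE [RHS]big_mkcond; apply: eq_bigr => i _; rewrite restrE.
by case: ifP => // _; rewrite Normc.normc0.
Qed.

Lemma norm1_restrC T v : norm1 v = norm1 (restr T v) + norm1 (restr (~: T) v).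
Proof.
rewrite !norm1_restr norm1_colE (bigID (mem T)) /=; congr (_ + _).
by apply: eq_bigl => i; rewrite inE.
Qed.

Lemma normF_le_card_supp v (M : R) : 0 <= M -> (forall i, normc (v i ord0) <= M) ->
  normF v <= Num.sqrt #|supp v|%:R * M.
Proof.
move=> M0 vM.
rewrite -(ger0_norm M0) -sqrtr_sqr -sqrtrM ?ler0n// normF_colE; apply: ler_wsqrtr.
rewrite mulr_natl -sumr_const big_mkcond [leRHS]big_mkcond /=; apply: ler_sum => i _.
rewrite inE; case: eqP => [->|_]; first by rewrite Normc.normc0 expr0n.
by rewrite lerXn2r// nnegrE normc_ge0.
Qed.

(* Greedy splitting: peel off the [s] largest entries; every remaining entry is
   then at most the mean of the entries just removed. *)
Lemma sparse_blocks (s : nat) v (M : R) : (0 < s)%N -> 0 <= M ->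
  (forall i, normc (v i ord0) <= M) ->
  exists ys : seq 'cV[R[i]]_d,
    [/\ v = \sum_(y <- ys) y,
        forall y, y \in ys -> supp y \subset supp v,
        forall y, y \in ys -> (#|supp y| <= s)%N &
        \sum_(y <- ys) normF y <= Num.sqrt s%:R * M + norm1 v / Num.sqrt s%:R].
Proof.
move=> s0; have sq0 : 0 < Num.sqrt (s%:R : R) by rewrite sqrtr_gt0 ltr0n.
have sqE : Num.sqrt (s%:R : R) / s%:R = (Num.sqrt s%:R)^-1.
  by rewrite -{2}(sqr_sqrtr (ler0n R s)) expr2 invfM mulrA divff ?mul1r// gt_eqF.
have [n] := ubnP #|supp v|; elim: n v M => // n IH v M; rewrite ltnS => vn M0 vM.
have leM w : (#|supp w| <= s)%N -> (forall i, normc (w i ord0) <= M) ->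
    normF w <= Num.sqrt s%:R * M.
  move=> ws wM; apply: le_trans (normF_le_card_supp M0 wM) _.
  by rewrite ler_wpM2r// ler_wsqrtr// ler_nat.
have [vs|sv] := leqP #|supp v| s.
  exists [:: v]; split=> [|y|y|]; rewrite ?big_seq1 ?inE//; try by move=> /eqP->.
  by rewrite -[leLHS]addr0 lerD ?leM ?divr_ge0 ?norm1_ge0 ?sqrtr_ge0.
have [T [Tv cT top]] := exists_largest (fun i => normc (v i ord0)) (ltnW sv).
have sTC : supp (restr (~: T) v) = supp v :\: T by rewrite supp_restr setDE.
(* The mean of the peeled block becomes the new entry bound. Its share [sqrt s * M] in the induction
   hypothesis is then the l1 mass of that block over [sqrt s], while the old [sqrt s * M] pays for
   the block itself. *)
have [||i|ys [vE ysv yss Lys]] := IH (restr (~: T) v) (norm1 (restr T v) / s%:R).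
- rewrite sTC cardsD (setIidPr Tv) cT; apply: leq_trans vn.
  by rewrite ltn_subrL s0 (leq_trans s0 (ltnW sv)).
- by rewrite divr_ge0 ?norm1_ge0.
- rewrite ler_pdivlMr ?ltr0n// restrE; have [iTC|_] := boolP (i \in ~: T); last first.
    by rewrite Normc.normc0 mul0r norm1_ge0.
  have [/eqP vi0|vi0] := boolP (v i ord0 == 0).
    by rewrite vi0 Normc.normc0 mul0r norm1_ge0.
  rewrite mulrC mulr_natl -cT -sumr_const norm1_restr; apply: ler_sum => j jT.
  by apply: top => //; rewrite !inE vi0 andbT -in_setC.
exists (restr T v :: ys); split=> [|y|y|].
- by rewrite big_cons -vE -restrC.
- rewrite inE => /orP[/eqP->|/ysv ysup]; first by rewrite supp_restr subsetIl.
  by apply: subset_trans ysup _; rewrite sTC subsetDl.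
- by rewrite inE => /orP[/eqP->|/yss//]; rewrite supp_restr (setIidPr Tv) cT.
rewrite big_cons (norm1_restrC T v) mulrDl; apply: lerD.
  apply: leM => [|i]; first by rewrite supp_restr (setIidPr Tv) cT.
  by rewrite restrE; case: ifP; rewrite ?Normc.normc0.
by apply: le_trans Lys _; rewrite mulrCA sqE.
Qed.

End Restriction.

(** * Quadratic measurements and the upper RIP bound on sums of sparse pieces *)

Section Measurements.
Variables (R : realType) (d m : nat) (av : 'I_m -> 'cV[R[i]]_d).
Implicit Types (X Y : 'M[R[i]]_d) (u v : 'cV[R[i]]_d).
Local Notation normc := (@Normc.normc R).

Lemma hermsymmxP X : X \is hermsymmx <-> X ^t* = X.
Proof.
split=> [/is_hermitianmxP|XE]; first by rewrite expr0 scale1r => <-.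
by apply/is_hermitianmxP; rewrite expr0 scale1r.
Qed.

Lemma hermsymmx_sym_outer u v : sym_outer u v \is hermsymmx.
Proof. by apply/hermsymmxP; rewrite adjmxD !adjmxM !adjmxK addrC. Qed.

Lemma hermsymmx_outer v : outer v \is hermsymmx.
Proof. by apply/hermsymmxP; rewrite adjmxM adjmxK. Qed.

Lemma hermsymmxB X Y : X \is hermsymmx -> Y \is hermsymmx -> X - Y \is hermsymmx.
Proof.
move=> /hermsymmxP XE /hermsymmxP YE; apply/hermsymmxP.
by rewrite linearB /= map_mxB XE YE.
Qed.

Lemma rank_mul_col_adj u v : (\rank (u *m v ^t*) <= 1)%N.
Proof. exact: leq_trans (mxrankM_maxl _ _) (rank_leq_col _). Qed.

Lemma rank_sym_outer u v : (\rank (sym_outer u v) <= 2)%N.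
Proof.
by apply: leq_trans (mxrank_add _ _) _; rewrite -[2%N]/(1 + 1)%N leq_add ?rank_mul_col_adj.
Qed.

Lemma rank_outerB u v : (\rank (outer u - outer v)%R <= 2)%N.
Proof.
apply: leq_trans (mxrank_add _ _) _; rewrite mxrank_opp.
by rewrite -[2%N]/(1 + 1)%N leq_add ?rank_mul_col_adj.
Qed.

Lemma norm02_le X (A : {set 'I_d}) : (forall i j, j \notin A -> X i j = 0) ->
  (norm02 X <= #|A|)%N.
Proof.
move=> X0; apply/subset_leq_card/subsetP => j; rewrite inE; apply: contraR => jA.
by apply/eqP/matrixP => i l; rewrite !mxE X0.
Qed.

Lemma notin_supp v i : i \notin supp v -> v i ord0 = 0.
Proof. by rewrite inE negbK => /eqP. Qed.

Lemma norm02_sym_outer u v : (norm02 (sym_outer u v) <= #|supp u| + #|supp v|)%N.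
Proof.
apply: leq_trans (leq_card_setU _ _); apply: norm02_le => i j.
rewrite inE negb_or => /andP[/notin_supp uj /notin_supp vj].
by rewrite mxE !mul_col_adjE uj vj conjC0 !mulr0 addr0.
Qed.

Lemma norm02_outer v : (norm02 (outer v) <= #|supp v|)%N.
Proof.
by apply: norm02_le => i j /notin_supp vj; rewrite mul_col_adjE vj conjC0 mulr0.
Qed.

Lemma norm02_outerB u v : (norm02 (outer u - outer v)%R <= #|supp u :|: supp v|)%N.
Proof.
apply: norm02_le => i j; rewrite inE negb_or => /andP[/notin_supp uj /notin_supp vj].
by rewrite mxE [X in _ + X]mxE !mul_col_adjE uj vj conjC0 !mulr0 subr0.
Qed.

Lemma quad_measD X Y : quad_meas av (X + Y) = quad_meas av X + quad_meas av Y.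
Proof.
apply/matrixP => i j; rewrite [LHS]mxE [RHS]mxE ![quad_meas _ _ _ _]mxE.
rewrite mulmxDr mulmxDl [X in complex.Re X]mxE.
by case: (_ ord0 ord0) => a b; case: (_ ord0 ord0).
Qed.

Lemma quad_measZ (t : R) X :
  quad_meas av (real_complex R t *: X) = t *: quad_meas av X.
Proof.
apply/matrixP => i j; rewrite [LHS]mxE [RHS]mxE ![quad_meas _ _ _ _]mxE.
rewrite -scalemxAr -scalemxAl [X in complex.Re X]mxE.
by case: (_ ord0 ord0) => a b /=; rewrite mul0r subr0.
Qed.

Lemma quad_meas0 : quad_meas av 0 = 0.
Proof. by apply: (addrI (quad_meas av 0)); rewrite -quad_measD !addr0. Qed.

Lemma ler_rnorm1D (y z : 'cV[R]_m) : rnorm1 (y + z) <= rnorm1 y + rnorm1 z.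
Proof.
by rewrite -big_split; apply: ler_sum => i _; rewrite mxE; exact: ler_normD.
Qed.

Lemma rnorm10 : rnorm1 (0 : 'cV[R]_m) = 0.
Proof. by rewrite /rnorm1 big1// => i _; rewrite mxE normr0. Qed.

Lemma rnorm2_ge0 (y : 'cV[R]_m) : 0 <= rnorm2 y. Proof. exact: sqrtr_ge0. Qed.

Lemma sqr_rnorm2 (y : 'cV[R]_m) : rnorm2 y ^+ 2 = \sum_i y i ord0 ^+ 2.
Proof. exact: (sqr_l2norm (fun i => y i ord0)). Qed.

Lemma rnorm1_le_rnorm2 (y : 'cV[R]_m) : m%:R^-1 * rnorm1 y <= rnorm2 y / Num.sqrt m%:R.
Proof.
have h : rnorm1 y <= Num.sqrt m%:R * rnorm2 y.
  have <- : l2norm (fun i => `|y i ord0|) = rnorm2 y.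
    by congr Num.sqrt; apply: eq_bigr => i _; rewrite real_normK ?num_real.
  have := sum_le_l2norm [set: 'I_m] (fun i => `|y i ord0|).
  rewrite cardsT card_ord; apply: le_trans.
  by rewrite le_eqVlt; apply/orP; left; apply/eqP/eq_bigl => i; rewrite inE.
(* For [m = 0] both sides are 0, since the inverse of 0 is 0. *)
have [m0|m0] := eqVneq m 0%N.
  have -> : m%:R = 0 :> R by rewrite m0.
  by rewrite invr0 mul0r sqrtr0 invr0 mulr0.
have sm : 0 < Num.sqrt (m%:R : R) by rewrite sqrtr_gt0 ltr0n lt0n.
rewrite -{1}(sqr_sqrtr (ler0n R m)) ler_pdivrMl ?exprn_gt0// expr2 -mulrA.
by rewrite [Num.sqrt m%:R * (_ / _)]mulrC divfK ?gt_eqF.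
Qed.

Lemma sqr_rnorm2B (y w : 'cV[R]_m) :
  rnorm2 (y - w) ^+ 2 = rnorm2 y ^+ 2 + rnorm2 w ^+ 2 - 2 * \sum_i y i ord0 * w i ord0.
Proof.
rewrite !sqr_rnorm2 mulr_sumr -big_split -sumrB; apply: eq_bigr => i _.
by rewrite !mxE /=; ring.
Qed.

(** Expand the square and apply Cauchy-Schwarz to the noise term. With [y] the measured error, a
    bound on the data misfit becomes a quadratic constraint on [rnorm2 y]. *)
Lemma sqr_rnorm2_le (y w : 'cV[R]_m) :
  rnorm2 y ^+ 2 <= rnorm2 (y - w) ^+ 2 - rnorm2 w ^+ 2 + 2 * (rnorm2 y * rnorm2 w).
Proof.
have : \sum_i y i ord0 * w i ord0 <= rnorm2 y * rnorm2 w by exact: cauchy_schwarz_sum.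
by rewrite sqr_rnorm2B; lra.
Qed.

Definition mean_meas X : R := m%:R^-1 * rnorm1 (quad_meas av X).

Lemma mean_measD X Y : mean_meas (X + Y) <= mean_meas X + mean_meas Y.
Proof.
by rewrite /mean_meas -mulrDr quad_measD ler_wpM2l ?invr_ge0// ler_rnorm1D.
Qed.

Lemma mean_meas0 : mean_meas 0 = 0.
Proof. by rewrite /mean_meas quad_meas0 rnorm10 mulr0. Qed.

Variables (c C K : R).
Hypothesis hRIP : RIP (quad_meas av) 2 K c C.

Lemma mean_meas_outer v : #|supp v|%:R <= K -> mean_meas (outer v) <= C * normF v ^+ 2.
Proof.
case: hRIP => _ _ h vK; rewrite -normF_outer; apply: (h _ _ _ _).2.
- exact: hermsymmx_outer.
- exact: leq_trans (rank_mul_col_adj _ _) _.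
- by apply: le_trans vK; rewrite ler_nat norm02_outer.
Qed.

Lemma mean_meas_sym_outer u v : (#|supp u| + #|supp v|)%:R <= K ->
  mean_meas (sym_outer u v) <= C * normF (sym_outer u v).
Proof.
case: hRIP => _ _ h vK; apply: (h _ _ _ _).2.
- exact: hermsymmx_sym_outer.
- exact: rank_sym_outer.
- by apply: le_trans vK; rewrite ler_nat norm02_sym_outer.
Qed.

(** RIP covers each [sym_outer u y], whereas their sum need not have few nonzero columns;
    subadditivity assembles the pieces. The parameter [r] serves both disjoint supports ([sqrt 2])
    and the general case ([2]). *)
Lemma mean_meas_cross u (ys : seq 'cV[R[i]]_d) (r : R) :
  (forall y, y \in ys -> (#|supp u| + #|supp y|)%:R <= K) ->
  (forall y, y \in ys -> normF (sym_outer u y) <= r * (normF u * normF y)) ->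
  mean_meas (sym_outer u (\sum_(y <- ys) y)) <=
    C * (r * (normF u * \sum_(y <- ys) normF y)).
Proof.
have [_ C0 _] := hRIP.
elim: ys => [|y ys IH] yK yr; first by rewrite !big_nil sym_outer0 mean_meas0 !mulr0.
rewrite !big_cons sym_outerDr; apply: le_trans (mean_measD _ _) _.
rewrite !mulrDr lerD//.
  apply: le_trans (mean_meas_sym_outer _) _; first by rewrite yK ?mem_head.
  by rewrite ler_pM2l// yr ?mem_head.
by apply: IH => z zys; [apply: yK|apply: yr]; rewrite inE zys orbT.
Qed.

(** The outer product of the sum expands into the [y_j y_j'] and cross terms on at most [2 s]
    columns; the bounds [C |y_j|^2] and [2 C |y_i| |y_j|] add up to [C] times the expanded
    square. *)
Lemma mean_meas_blocks (ys : seq 'cV[R[i]]_d) (s : nat) : (s + s)%:R <= K ->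
  (forall y, y \in ys -> (#|supp y| <= s)%N) ->
  mean_meas (outer (\sum_(y <- ys) y)) <= C * (\sum_(y <- ys) normF y) ^+ 2.
Proof.
move=> sK; elim: ys => [|y ys IH] yss.
  by rewrite !big_nil outer0 mean_meas0 expr0n mulr0.
have ys' z : z \in ys -> (#|supp z| <= s)%N by move=> zys; rewrite yss// inE zys orbT.
have y' : (#|supp y| <= s)%N by rewrite yss ?mem_head.
rewrite !big_cons outerD sqrrD.
apply: le_trans (mean_measD _ _) _; apply: le_trans (lerD (mean_measD _ _) (lexx _)) _.
rewrite addrAC mulrDr mulrDr; apply: lerD; last exact: IH.
apply: lerD.
  by apply: mean_meas_outer; apply: le_trans sK; rewrite ler_nat (leq_trans y')// leq_addr.
rewrite -mulr_natl; apply: mean_meas_cross => z zys.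
  by apply: le_trans sK; rewrite ler_nat leq_add// ys'.
exact: normF_sym_outer_le.
Qed.

End Measurements.

Lemma normF_sum_le (R : realType) d (ys : seq 'cV[R[i]]_d) :
  normF (\sum_(y <- ys) y) <= \sum_(y <- ys) normF y.
Proof.
elim: ys => [|y ys IH]; rewrite ?big_nil ?big_cons.
  by rewrite normF_colE /l2norm big1 ?sqrtr0// => i _; rewrite mxE Normc.normc0 expr0n.
by apply: le_trans (ler_normFD _ _) _; rewrite lerD2l.
Qed.

(** * Scalar inequalities behind the error bound *)

(** To be read with [p = 1 / sqrt a], [P = 1 / sqrt (mu a k)], [r = sqrt 2], [e = |w|_2],
    [g = e / sqrt mu], [rm = 1 / sqrt m], [h = |H|_F], [t] the residual, and [V], [W] the cross and
    tail terms. Eliminating [t] bounds [h] by noise, and inserting this into the bound on [F]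
    produces [alpha]. *)
Lemma final_estimate (R : realFieldType) (c C p P g r e h t rm N0 F V W : R) :
  0 < C -> 0 < p <= 1 -> 0 < P -> 7 / 5 <= r -> 0 <= e -> 0 <= h -> 0 <= N0 ->
  P * e <= g -> 0 < c - C * p ^+ 2 - 4 * r * C * p ->
  c * h <= t * rm + C * V + C * W ->
  F <= h + V + W ->
  V <= 4 * h * p + 2 * P * e * (N0 + g / r) ->
  W <= 2 * h * p ^+ 2 + P ^+ 2 * (2 * t * e - t ^+ 2) ->
  let alpha := (1 + p ^+ 2 + 4 * r * p) / (c - C * p ^+ 2 - 4 * r * C * p) in
  F <= (2 * C * alpha + 2) * (e * P) * (N0 + g) + e ^+ 2 * P ^+ 2 / 2 +
    alpha / (2 * C * P ^+ 2) * (C * e * P ^+ 2 + rm) ^+ 2.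
Proof.
move=> C0 /andP[p0 p1] P0 r75 e0 h0 N00 Peg gam0 H1 HF HV HW /=.
have r0 : 0 < r by apply: lt_le_trans r75; lra.
set gam := c - _ - _ in gam0 *; set alpha := _ / gam.
(* The slack [4 * (r - 1) * p] pays for the second copy of [p ^+ 2], as [p <= 1]. *)
have hp : h * (4 * p + 2 * p ^+ 2) <= h * (p ^+ 2 + 4 * r * p).
  by apply: ler_wpM2l => //; nra.
have ePg0 : 0 <= e * P * g.
  rewrite !mulr_ge0 ?(ltW P0)//; apply: le_trans Peg.
  by rewrite mulr_ge0 ?(ltW P0).
have eP2 : e ^+ 2 * P ^+ 2 <= e * P * g.
  have -> : e ^+ 2 * P ^+ 2 = e * P * (P * e) by ring.
  by rewrite ler_wpM2l// mulr_ge0 ?(ltW P0).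
have gr : e * P * (g / r) <= e * P * g * (5 / 7).
  rewrite mulrA; apply: ler_wpM2l => //.
  have -> : 5 / 7 = (7 / 5)^-1 :> R by field.
  by rewrite lef_pV2 ?posrE//; lra.
(* The excess [e ^+ 2 * P ^+ 2 / 2] is at most half of [e * P * g], and replacing [g / r] by [g]
   gains at least [2 * (1 - 5 / 7) = 4 / 7] of it. *)
have VW : 2 * P * e * (N0 + g / r) + e ^+ 2 * P ^+ 2 <=
    2 * (e * P) * (N0 + g) + e ^+ 2 * P ^+ 2 / 2.
  by lra.
pose B := 2 * C * (e * P) * (N0 + g) + (C * e * P ^+ 2 + rm) ^+ 2 / (2 * C * P ^+ 2).
have Wt : P ^+ 2 * (2 * t * e - t ^+ 2) <= e ^+ 2 * P ^+ 2.
  rewrite -subr_ge0.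
  have -> : e ^+ 2 * P ^+ 2 - P ^+ 2 * (2 * t * e - t ^+ 2) = P ^+ 2 * (t - e) ^+ 2 by ring.
  by rewrite mulr_ge0 ?sqr_ge0.
have CP0 : 0 < C * P ^+ 2 by rewrite mulr_gt0 ?exprn_gt0.
(* Completing the square in [t]: the maximum is at [t = e + rm / (2 * C * P ^+ 2)], and the stated
   bound exceeds it by [rm ^+ 2 / (4 * C * P ^+ 2)]. *)
have quad : t * rm + C * (P ^+ 2 * (2 * t * e - t ^+ 2)) <=
    C * e ^+ 2 * P ^+ 2 + e * rm + rm ^+ 2 / (2 * C * P ^+ 2).
  rewrite -subr_ge0.
  have -> : C * e ^+ 2 * P ^+ 2 + e * rm + rm ^+ 2 / (2 * C * P ^+ 2)
     - (t * rm + C * (P ^+ 2 * (2 * t * e - t ^+ 2))) =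
     C * P ^+ 2 * (t - e - rm / (2 * (C * P ^+ 2))) ^+ 2 + rm ^+ 2 / (4 * (C * P ^+ 2)).
    by field; rewrite !gt_eqF.
  have CP := ltW CP0; apply: addr_ge0; first by rewrite mulr_ge0 ?sqr_ge0.
  by rewrite divr_ge0 ?sqr_ge0// mulr_ge0.
have CV : C * V <= C * (4 * h * p + 2 * P * e * (N0 + g / r)) by rewrite ler_pM2l.
have CW : C * W <= C * (2 * h * p ^+ 2 + P ^+ 2 * (2 * t * e - t ^+ 2)) by rewrite ler_pM2l.
have Chp := ler_wpM2l (ltW C0) hp.
have CVW := ler_wpM2l (ltW C0) VW.
have BE : B = 2 * C * (e * P) * (N0 + g) + C * e ^+ 2 * P ^+ 2 / 2 + e * rm +
    rm ^+ 2 / (2 * C * P ^+ 2).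
  by rewrite /B; field; rewrite !gt_eqF.
have ghB : gam * h <= B by rewrite BE /gam; lra.
have hB : h <= B / gam by rewrite ler_pdivlMr// mulrC.
have s0 : 0 <= 1 + p ^+ 2 + 4 * r * p by rewrite !addr_ge0 ?sqr_ge0// !mulr_ge0// ltW.
have := ler_wpM2l s0 hB.
have -> : (1 + p ^+ 2 + 4 * r * p) * (B / gam) = alpha * B by rewrite /alpha; ring.
move=> hA.
have -> : (2 * C * alpha + 2) * (e * P) * (N0 + g) + e ^+ 2 * P ^+ 2 / 2 +
    alpha / (2 * C * P ^+ 2) * (C * e * P ^+ 2 + rm) ^+ 2 =
    alpha * B + (2 * (e * P) * (N0 + g) + e ^+ 2 * P ^+ 2 / 2) by rewrite /B; ring.
by lra.
Qed.

Lemma sqrt2_ge (R : rcfType) : 7 / 5 <= Num.sqrt 2 :> R.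
Proof.
rewrite -(@ler_pXn2r _ 2)// ?nnegrE ?sqrtr_ge0 ?divr_ge0// sqr_sqrtr//.
by lra.
Qed.

(** Here [N] and [N0] are the l1 norms of [x#] and [x0], [n0] and [l] the parts of [N] on and off
    [S], [U = |u|], [D = |u - x0|], [q] the squared misfit, and [sa], [sk], [sm] the roots of [a],
    [k], [mu]. Minimality is used twice: without [q] it bounds [N], with [q] it bounds [l ^+ 2] and
    keeps the term [- t ^+ 2]. *)
Lemma tail_estimates (R : realFieldType) (r sa sk sm e h t N N0 n0 l U D L q : R) :
  r ^+ 2 = 2 -> 0 < r -> 0 < sa -> 0 < sk -> 0 < sm ->
  0 <= e -> 0 <= h -> 0 <= N0 -> 0 <= n0 -> 0 <= l -> 0 <= L -> 0 <= U ->
  N = n0 + l -> N0 - n0 <= sk * D -> N0 ^+ 2 - n0 ^+ 2 <= sk ^+ 2 * h ->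
  U * D <= r * h -> U <= N -> L <= r / (sa * sk) * l -> 0 <= q ->
  sm ^+ 2 * N ^+ 2 + 1 / 2 * q <= sm ^+ 2 * N0 ^+ 2 + 1 / 2 * e ^+ 2 ->
  t ^+ 2 <= q - e ^+ 2 + 2 * (t * e) ->
  2 * U * L <= 4 * h * sa^-1 + 2 * (sa * sk * sm)^-1 * e * (N0 + e / sm / r) /\
  L ^+ 2 <= 2 * h * sa^-1 ^+ 2 + (sa * sk * sm)^-1 ^+ 2 * (2 * t * e - t ^+ 2).
Proof.
move=> rE r0 sa0 sk0 sm0 e0 h0 N00 n00 l0 L0 U0 NE hD hh UD UN HL q0 hmin ht.
have sk20 : 0 < r / (sa * sk) by rewrite divr_gt0// mulr_gt0.
have sm20 : 0 < sm ^+ 2 by rewrite exprn_gt0.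
set G := e / sm / r; have G0 : 0 <= G by rewrite !divr_ge0// ltW.
have GE : sm ^+ 2 * G ^+ 2 = e ^+ 2 / 2.
  by rewrite /G !exprMn !exprVn rE; field; rewrite gt_eqF.
have N0' : 0 <= N by rewrite NE addr_ge0.
have HN : N <= N0 + G.
  rewrite -(@ler_pXn2r _ 2)// ?nnegrE ?addr_ge0//.
  rewrite -(ler_pM2l sm20).
  have : 0 <= sm ^+ 2 * (2 * (N0 * G)).
    exact: mulr_ge0 (ltW sm20) (mulr_ge0 (ler0n _ 2) (mulr_ge0 N00 G0)).
  have -> : sm ^+ 2 * (N0 + G) ^+ 2 = sm ^+ 2 * N0 ^+ 2 + e ^+ 2 / 2 + sm ^+ 2 * (2 * (N0 * G)).
    by rewrite -GE; ring.
  by move: hmin q0; clear; lra.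
split.
  (* Split [l] into [sk * D] and the l1 excess [N - N0]: alignment controls [U * D], while
     [U <= N <= N0 + G] and [N - N0 <= G] control the rest. *)
  have Ul : U * l <= sk * (r * h) + (N0 + G) * G.
    have UG : U * (N - N0) <= (N0 + G) * G.
      apply: (@le_trans _ _ (U * G)); first by rewrite ler_wpM2l// lerBlDl.
      by rewrite ler_wpM2r// (le_trans UN).
    have lD : l <= sk * D + (N - N0) by move: hD; rewrite NE; clear; lra.
    apply: le_trans (ler_wpM2l U0 lD) _; rewrite mulrDr lerD// mulrCA.
    by rewrite ler_pM2l.
  have -> : 4 * h * sa^-1 + 2 * (sa * sk * sm)^-1 * e * (N0 + G) =
      2 * (r / (sa * sk) * (sk * (r * h) + (N0 + G) * G)).
    have -> : 4 * h = 2 * r ^+ 2 * h by rewrite rE; ring.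
    have -> : 2 * (sa * sk * sm)^-1 * e = 2 * (r / (sa * sk)) * G.
      by rewrite /G; field; rewrite !gt_eqF.
    by field; rewrite !gt_eqF.
  rewrite -mulrA ler_pM2l//; apply: le_trans (ler_wpM2l U0 HL) _.
  by rewrite mulrCA ler_pM2l.
(* Dropping [2 * n0 * l] from [N ^+ 2] leaves [n0 ^+ 2 + l ^+ 2]; [hh] then trades
   [N0 ^+ 2 - n0 ^+ 2] for [h]. *)
have l2 : sm ^+ 2 * l ^+ 2 <= sm ^+ 2 * (sk ^+ 2 * h) + (2 * t * e - t ^+ 2) / 2.
  have nl : 0 <= sm ^+ 2 * (n0 * l) := mulr_ge0 (ltW sm20) (mulr_ge0 n00 l0).
  have := ler_wpM2l (ltW sm20) hh.
  have : sm ^+ 2 * N ^+ 2 = sm ^+ 2 * n0 ^+ 2 + 2 * (sm ^+ 2 * (n0 * l)) + sm ^+ 2 * l ^+ 2.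
    by rewrite NE; ring.
  by move: hmin ht nl; rewrite mulrBr; clear; lra.
apply: (@le_trans _ _ ((r / (sa * sk) * l) ^+ 2)).
  by rewrite lerXn2r// nnegrE mulr_ge0// ltW.
have -> : 2 * h * sa^-1 ^+ 2 + (sa * sk * sm)^-1 ^+ 2 * (2 * t * e - t ^+ 2) =
    2 * (sa * sk * sm)^-1 ^+ 2 * (sm ^+ 2 * (sk ^+ 2 * h) + (2 * t * e - t ^+ 2) / 2).
  by field; rewrite !gt_eqF.
have -> : (r / (sa * sk) * l) ^+ 2 = 2 * (sa * sk * sm)^-1 ^+ 2 * (sm ^+ 2 * l ^+ 2).
  by rewrite -rE; field; rewrite !gt_eqF.
by rewrite ler_pM2l// mulr_gt0// exprn_gt0// invr_gt0 !mulr_gt0.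
Qed.

(** * Deviation of l1 masses, and phase alignment *)

Section Deviation.
Variables (R : realType) (d : nat).
Implicit Types (u v x : 'cV[R[i]]_d) (T : {set 'I_d}).
Local Notation normc := (@Normc.normc R).

Lemma sqr_normF_restr T v : normF (restr T v) ^+ 2 = \sum_(i in T) normc (v i ord0) ^+ 2.
Proof.
rewrite normF_colE sqr_l2norm [RHS]big_mkcond; apply: eq_bigr => i _; rewrite restrE.
by case: ifP => // _; rewrite Normc.normc0 expr0n.
Qed.

Lemma normF_restrU T1 T2 v : [disjoint T1 & T2] ->
  normF (restr T1 v) + normF (restr T2 v) <= Num.sqrt 2 * normF (restr (T1 :|: T2) v).
Proof.
move=> T12.
rewrite -(@ler_pXn2r _ 2)// ?nnegrE ?mulr_ge0 ?addr_ge0 ?normF_ge0 ?sqrtr_ge0//.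
rewrite exprMn [Num.sqrt 2 ^+ 2]sqr_sqrtr//.
have -> : normF (restr (T1 :|: T2) v) ^+ 2 =
    normF (restr T1 v) ^+ 2 + normF (restr T2 v) ^+ 2.
  by rewrite !sqr_normF_restr -bigU //=; apply: eq_bigl => i; rewrite inE.
have := sqr_ge0 (normF (restr T1 v) - normF (restr T2 v)).
by lra.
Qed.

Lemma sum_normc_le_card T u v :
  \sum_(i in T) normc (v i ord0) - \sum_(i in T) normc (u i ord0) <=
    Num.sqrt #|T|%:R * normF (u - v).
Proof.
rewrite normF_colE; apply: le_trans (sum_le_l2norm _ _).
rewrite -sumrB; apply: ler_sum => i _; rewrite lerBlDl.
have -> : v i ord0 = u i ord0 + - (u - v) i ord0 by rewrite !mxE; ring.
by apply: le_trans (ler_normcD _ _) _; rewrite normcN.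
Qed.

(** The squared l1 mass on [T] is the l1 norm of the [T] by [T] block of the outer product, so
    Cauchy-Schwarz over [#|T| ^ 2] entries gives the factor [#|T|]. *)
Lemma sqr_sum_normc_le_card T u v :
  (\sum_(i in T) normc (v i ord0)) ^+ 2 - (\sum_(i in T) normc (u i ord0)) ^+ 2 <=
    #|T|%:R * normF (outer u - outer v).
Proof.
have sqE (w : 'cV[R[i]]_d) : (\sum_(i in T) normc (w i ord0)) ^+ 2 =
    \sum_(p in setX T T) normc (outer w p.1 p.2).
  rewrite expr2 big_distrlr /= pair_big; apply: eq_big => [[i j]|p _]; first by rewrite in_setX.
  by rewrite mul_col_adjE Normc.normcM normc_conj.
rewrite !sqE normFE.
have -> : #|T|%:R = Num.sqrt #|setX T T|%:R :> R.
  by rewrite cardsX natrM -expr2 sqrtr_sqr ger0_norm.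
apply: le_trans (sum_le_l2norm _ _).
rewrite -sumrB; apply: ler_sum => p _; rewrite lerBlDl.
have -> : outer v p.1 p.2 = outer u p.1 p.2 + - (outer u - outer v) p.1 p.2.
  by rewrite [(outer u - outer v)%R p.1 p.2]mxE [(- outer v)%R p.1 p.2]mxE; ring.
by apply: le_trans (ler_normcD _ _) _; rewrite normcN.
Qed.

Lemma outerZ (z : R[i]) v : outer (z *: v) = (z * Num.conj z) *: outer v.
Proof.
apply/matrixP => i j; rewrite mul_col_adjE !mxE big_ord1 !mxE rmorphM /=.
by rewrite mulrACA.
Qed.

Lemma exists_phase (z : R[i]) : exists w : R[i],
  [/\ normc w = 1, w * Num.conj w = 1 & Num.conj w * z = real_complex R (normc z)].
Proof.
have conjM (y : R[i]) : y * Num.conj y = real_complex R (normc y ^+ 2).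
  by rewrite sqr_normcE conjCE; case: y => a b; simpc => /=; congr (_ +i* _)%C; ring.
have [->|z0] := eqVneq z 0.
  by exists 1; rewrite Normc.normc1 conjC1 !mulr1 mulr0 Normc.normc0.
have nz : normc z != 0 by rewrite normc_eq0.
pose w := z / real_complex R (normc z).
have w1 : normc w = 1.
  rewrite Normc.normcM Normc.normcV /= expr0n addr0 sqrtr_sqr ger0_norm ?normc_ge0//.
  by rewrite divff.
have ww : w * Num.conj w = 1 by rewrite conjM w1 expr1n.
exists w; split=> //.
have -> : z = w * real_complex R (normc z).
  by rewrite divfK//; apply: contra nz => /eqP[->].
by rewrite Normc.normcM w1 mul1r mulrCA mulrA ww mul1r /= expr0n
  addr0 sqrtr_sqr ger0_norm ?normc_ge0.
Qed.

Lemma exists_aligned u v : exists v' : 'cV[R[i]]_d,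
  [/\ outer v' = outer v, forall i, normc (v' i ord0) = normc (v i ord0),
      0 <= complex.Re (\sum_i u i ord0 * Num.conj (v' i ord0)) &
      complex.Im (\sum_i u i ord0 * Num.conj (v' i ord0)) = 0].
Proof.
have [w [w1 ww wz]] := exists_phase (\sum_i u i ord0 * Num.conj (v i ord0)).
have E : \sum_i u i ord0 * Num.conj ((w *: v) i ord0) =
    real_complex R (normc (\sum_i u i ord0 * Num.conj (v i ord0))).
  rewrite -wz mulr_sumr; apply: eq_bigr => i _.
  by rewrite !mxE rmorphM /= mulrCA.
exists (w *: v); split.
- by rewrite outerZ ww scale1r.
- by move=> i; rewrite mxE Normc.normcM w1 mul1r.
- by rewrite E normc_ge0.
- by rewrite E.
Qed.

End Deviation.

(** * What minimality implies for the objective values *)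

Section Minimizer.
Variables (R : realType) (d m : nat) (av : 'I_m -> 'cV[R[i]]_d).
Implicit Types (X Y : 'M[R[i]]_d) (u v : 'cV[R[i]]_d).

Lemma quad_measN X : quad_meas av (- X) = - quad_meas av X.
Proof.
by apply: (addrI (quad_meas av X)); rewrite -quad_measD !subrr quad_meas0.
Qed.

Lemma mean_measN X : mean_meas av (- X) = mean_meas av X.
Proof.
by rewrite /mean_meas quad_measN; congr (_ * _); apply: eq_bigr => i _; rewrite mxE normrN.
Qed.

Lemma psd_outer v : psd (outer v).
Proof.
split=> [|x]; first exact: hermsymmx_outer.
have -> : x ^t* *m outer v *m x = (v ^t* *m x) ^t* *m (v ^t* *m x).
  by rewrite adjmxM adjmxK /outer !mulmxA.
by rewrite mxE big_ord1 !mxE mulrC mul_conjC_ge0.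
Qed.

Lemma rank_outer v : v != 0 -> \rank (outer v) = 1%N.
Proof.
move=> v0; apply/eqP; rewrite eqn_leq rank_mul_col_adj lt0n mxrank_eq0.
apply: contra v0 => /eqP O; apply/eqP/matrixP => i j; rewrite (ord1 j) mxE; apply/eqP.
have := mul_col_adjE v v i i; rewrite -/(outer v) O mxE => /esym/eqP.
by rewrite mul_conjC_eq0.
Qed.

(* The competitor [outer x0] is infeasible when [x0 = 0]; then compare with
   [t *: outer x] and let [t] tend to [0]. *)
Lemma minimizer_objective_le (mu : R) (x x0 : 'cV[R[i]]_d) (w : 'cV[R]_m) : 0 < mu ->
  is_minimizer (fun X : 'M[R[i]]_d => psd X /\ \rank X = 1%N)
    (fun X => mu * norm1 X + 1 / 2 * rnorm2 (quad_meas av X - (quad_meas av (outer x0) + w)) ^+ 2)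
    (outer x) ->
  mu * norm1 x ^+ 2 + 1 / 2 * rnorm2 (quad_meas av (outer x - outer x0) - w) ^+ 2 <=
    mu * norm1 x0 ^+ 2 + 1 / 2 * rnorm2 w ^+ 2.
Proof.
move=> mu0 [[_ rx] xmin].
have [f fE] : exists f : 'M[R[i]]_d -> R, forall X, f X = mu * norm1 X +
    1 / 2 * rnorm2 (quad_meas av X - (quad_meas av (outer x0) + w)) ^+ 2 by eexists.
have fmin Y : psd Y -> \rank Y = 1%N -> f (outer x) <= f Y.
  by move=> pY rY; rewrite fE (fE Y); exact: xmin.
have fdev X : f X = mu * norm1 X + 1 / 2 * rnorm2 (quad_meas av (X - outer x0) - w) ^+ 2.
  by rewrite fE; congr (_ + _ * rnorm2 _ ^+ 2); rewrite quad_measD quad_measN opprD addrA.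
have fx : f (outer x) = mu * norm1 x ^+ 2 +
    1 / 2 * rnorm2 (quad_meas av (outer x - outer x0) - w) ^+ 2.
  by rewrite fdev norm1_outer.
rewrite -fx; clear xmin.
have rnorm2N (y : 'cV[R]_m) : rnorm2 (- y) = rnorm2 y.
  by congr Num.sqrt; apply: eq_bigr => i _; rewrite mxE sqrrN.
have [x00|x00] := eqVneq x0 0; last first.
  apply: le_trans (fmin _ (psd_outer x0) (rank_outer x00)) _.
  by rewrite fdev norm1_outer subrr quad_meas0 sub0r rnorm2N.
have -> : norm1 x0 = 0.
  by rewrite x00 norm1_colE big1// => i _; rewrite mxE Normc.normc0.
rewrite expr0n mulr0 add0r.
have x_neq0 : x != 0.
  by apply/eqP => x0E; move: rx; rewrite x0E outer0 mxrank0.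
set Q := quad_meas av (outer x).
(* For [t <= 1] the objective at [t *: outer x] exceeds its limit at 0 by at most [t * B]; the
   choice [t = e / (B + e)] below gives both [t <= 1] and [t * B <= e]. *)
pose B := mu * norm1 x ^+ 2 + (rnorm2 Q ^+ 2 / 2 + `|\sum_i Q i ord0 * w i ord0|).
have B0 : 0 <= B.
  apply: addr_ge0; first by rewrite mulr_ge0 ?sqr_ge0 ?(ltW mu0).
  by rewrite addr_ge0 ?divr_ge0 ?sqr_ge0.
apply/ler_addgt0Pr => e e0.
pose t := e / (B + e); have Be0 : 0 < B + e by rewrite ltr_wpDl.
have t0 : 0 < t by rewrite divr_gt0.
have t1 : t <= 1 by rewrite ler_pdivrMr// mul1r lerDr.
have tB : t * B <= e by rewrite mulrAC ler_pdivrMr// ler_pM2l// lerDl ltW.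
have sx : real_complex R (Num.sqrt t) *: x != 0.
  rewrite scaler_eq0 negb_or x_neq0 andbT; apply/eqP => -[/eqP].
  by rewrite sqrtr_eq0 leNgt t0.
have tO : outer (real_complex R (Num.sqrt t) *: x) = real_complex R t *: outer x.
  rewrite outerZ; congr (_ *: _).
  by rewrite conjCE /= oppr0 -rmorphM -expr2 /= sqr_sqrtr ?(ltW t0).
apply: le_trans (fmin _ (psd_outer _) (rank_outer sx)) _.
rewrite tO fdev x00 outer0 subr0 quad_measZ -/Q.
have -> : norm1 (real_complex R t *: outer x) = t * norm1 x ^+ 2.
  rewrite -norm1_outer /norm1 mulr_sumr; apply: eq_bigr => i _; rewrite mulr_sumr.
  apply: eq_bigr => j _; rewrite mxE Normc.normcM /= expr0n addr0 sqrtr_sqr.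
  by rewrite ger0_norm// ltW.
rewrite (sqr_rnorm2B (t *: Q)).
have -> : rnorm2 (t *: Q) ^+ 2 = t ^+ 2 * rnorm2 Q ^+ 2.
  by rewrite !sqr_rnorm2 mulr_sumr; apply: eq_bigr => i _; rewrite mxE exprMn.
have -> : \sum_i (t *: Q) i ord0 * w i ord0 = t * \sum_i Q i ord0 * w i ord0.
  by rewrite mulr_sumr; apply: eq_bigr => i _; rewrite mxE mulrA.
have h1 : t ^+ 2 * rnorm2 Q ^+ 2 <= t * rnorm2 Q ^+ 2.
  by rewrite ler_wpM2r ?sqr_ge0// expr2 ler_piMr// ltW.
have h2 : - (t * \sum_i Q i ord0 * w i ord0) <= t * `|\sum_i Q i ord0 * w i ord0|.
  by rewrite -mulrN ler_pM2l// -normrN ler_norm.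
by move: tB; rewrite /B; lra.
Qed.

End Minimizer.

(** * Head and tail splitting, and the error bound for aligned vectors *)

Section AlignedBound.
Variables (R : realType) (d m k : nat) (av : 'I_m -> 'cV[R[i]]_d) (a c C mu : R).
Variables (x0 x : 'cV[R[i]]_d) (w : 'cV[R]_m).
Local Notation normc := (@Normc.normc R).

(* [a * k] need not be an integer: blocks of size [floor (a k) >= a k / 2] double
   the bound on the squared sum of the block norms, a loss absorbed by the slack
   in [4 sqrt 2 / sqrt a] and in the cross term of the noise. *)
Lemma head_tail_split : (0 < k)%N -> 1 <= a -> sparse k x0 ->
  exists (T : {set 'I_d}) (s : nat) (ys : seq 'cV[R[i]]_d),
  [/\ [/\ [disjoint supp x0 & T], (#|T| <= s)%N, a * k%:R <= 2 * s%:R & s%:R <= a * k%:R],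
      restr (~: (supp x0 :|: T)) x = \sum_(y <- ys) y,
      forall y, y \in ys -> supp y \subset ~: (supp x0 :|: T),
      forall y, y \in ys -> (#|supp y| <= s)%N &
      \sum_(y <- ys) normF y <= norm1 (restr (~: supp x0) x) / Num.sqrt s%:R].
Proof.
move=> k0 a1 spx0; set S := supp x0.
have k1 : 1 <= k%:R :> R by rewrite ler1n.
have ak1 : 1 <= a * k%:R by exact: mulr_ege1.
pose s := Num.truncn (a * k%:R).
have s0 : (0 < s)%N by rewrite truncn_gt0.
have /andP[sak aks] := truncn_itv (le_trans ler01 ak1).
have [T [TS Ts top]] := exists_largest_sum (fun i => normc (x i ord0)) s (~: S).
have ST : [disjoint S & T] by rewrite disjoint_sym disjoints_subset.
(* The mean over [T] is the initial entry bound, so the first term of the block estimate is the mass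
   of [T] over [sqrt s]; with the tail mass it adds up to the whole mass off [S]. *)
have [||ys [zE zs yss Ly]] :=
    @sparse_blocks R d s (restr (~: (S :|: T)) x) (norm1 (restr T x) / s%:R) s0.
- by rewrite divr_ge0 ?norm1_ge0.
- move=> i; rewrite ler_pdivlMr ?ltr0n// restrE; case: ifPn => [iC|_]; last first.
    by rewrite Normc.normc0 mul0r norm1_ge0.
  rewrite norm1_restr mulrC; apply: top.
  by move: iC; rewrite !inE negb_or andbC.
exists T, s, ys; split=> //.
(* [a k < s + 1 <= 2 s], because [s >= 1]. *)
- split=> //; apply: le_trans (ltW aks) _.
  by rewrite -natrM ler_nat mul2n -addnn -addn1 leq_add2l.
- by move=> y /zs ys'; apply: subset_trans ys' _; rewrite supp_restr subsetIr.
apply: le_trans Ly _.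
have -> : norm1 (restr (~: S) x) = norm1 (restr T x) + norm1 (restr (~: (S :|: T)) x).
  rewrite !norm1_restr -bigU /=; last first.
    by rewrite disjoint_sym disjoints_subset setCS subsetUr.
  have TSi i : i \in T -> i \notin S by move/(subsetP TS); rewrite in_setC.
  apply: eq_bigl => i; rewrite [RHS]inE /= !in_setC in_setU; move/implyP: (TSi i).
  by case: (i \in T) (i \in S) => [] [].
have sq0 : 0 < Num.sqrt (s%:R : R) by rewrite sqrtr_gt0 ltr0n.
have sqE : Num.sqrt (s%:R : R) / s%:R = (Num.sqrt s%:R)^-1.
  by rewrite -{2}(sqr_sqrtr (ler0n R s)) expr2 invfM mulrA divff ?mul1r// gt_eqF.
by rewrite mulrCA sqE mulrDl.
Qed.

(** Minimality enters only as a comparison of objective values, which is unaffected by the phase of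
    [x0]. RIP supplies [H1], and the two scalar lemmas do the rest. *)
Lemma aligned_error_bound : (0 < k)%N -> 1 <= a -> 0 < mu ->
  RIP (quad_meas av) 2 (2 * a * k%:R) c C ->
  0 < c - 4 * Num.sqrt 2 * C / Num.sqrt a - C / a ->
  sparse k x0 ->
  mu * norm1 x ^+ 2 + 1 / 2 * rnorm2 (quad_meas av (outer x - outer x0) - w) ^+ 2 <=
    mu * norm1 x0 ^+ 2 + 1 / 2 * rnorm2 w ^+ 2 ->
  0 <= complex.Re (\sum_i x i ord0 * Num.conj (x0 i ord0)) ->
  complex.Im (\sum_i x i ord0 * Num.conj (x0 i ord0)) = 0 ->
  let alpha : R := (1 + 1 / a + 4 * Num.sqrt 2 / Num.sqrt a)
                   / (c - C / a - 4 * Num.sqrt 2 * C / Num.sqrt a) in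
  normF (outer x - outer x0) <=
    (2 * C * alpha + 2) * (rnorm2 w / Num.sqrt (mu * a * k%:R))
      * (norm1 x0 + rnorm2 w / Num.sqrt mu)
    + rnorm2 w ^+ 2 / (2 * mu * a * k%:R)
    + alpha * (mu * a * k%:R / (2 * C))
      * (C * rnorm2 w / (mu * a * k%:R) + 1 / Num.sqrt m%:R) ^+ 2.
Proof.
move=> k0 a1 mu0 hRIP hgam spx0 hmin hRe hIm /=.
have [c0 C0 hR] := hRIP.
have a0 : 0 < a by exact: lt_le_trans a1.
have kR0 : 0 < k%:R :> R by rewrite ltr0n.
have k1 : 1 <= k%:R :> R by rewrite ler1n.
have kak : k%:R <= a * k%:R by rewrite ler_peMl.
have twoak : 2 * a * k%:R = a * k%:R + a * k%:R by ring.
have [T [s [ys [[ST Ts ak2s sak] zE ysup yss Lle]]]] := head_tail_split k0 a1 spx0.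
set S := supp x0 in ST zE ysup Lle; have cS : (#|S| <= k)%N := spx0.
pose u := restr (S :|: T) x; pose z := \sum_(y <- ys) y; pose L := \sum_(y <- ys) normF y.
have xE : x = u + z by rewrite /z -zE -restrC.
pose H := outer u - outer x0; pose h := normF H.
pose l := norm1 (restr (~: S) x); pose n0 := \sum_(i in S) normc (x i ord0).
have h0 : 0 <= h by exact: normF_ge0.
have l0 : 0 <= l by exact: norm1_ge0.
have L0 : 0 <= L by rewrite sumr_ge0// => y _; exact: normF_ge0.
have U0 : 0 <= normF u by exact: normF_ge0.
have e0 : 0 <= rnorm2 w by exact: rnorm2_ge0.
have N00 : 0 <= norm1 x0 by exact: norm1_ge0.
have n00 : 0 <= n0 by rewrite sumr_ge0// => i _; exact: normc_ge0.
have xN : norm1 x = n0 + l by rewrite (norm1_restrC S) norm1_restr.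
have x0N : norm1 x0 = \sum_(i in S) normc (x0 i ord0).
  rewrite norm1_colE [RHS]big_mkcond; apply: eq_bigr => i _; rewrite inE.
  by case: eqP => // ->; rewrite Normc.normc0.
have uS i : i \in S -> u i ord0 = x i ord0 by move=> iS; rewrite restrE inE iS.
have n0E : n0 = \sum_(i in S) normc (u i ord0) by apply: eq_bigr => i /uS ->.
have UN : normF u <= norm1 x.
  apply: le_trans (normF_le_norm1 _) _.
  by rewrite [leRHS](norm1_restrC (S :|: T)) lerDl norm1_ge0.
have UD : normF u * normF (u - x0) <= Num.sqrt 2 * h.
  (* [u] agrees with [x] on the support of [x0], so it inherits the alignment. *)
  have E : \sum_i u i ord0 * Num.conj (x0 i ord0) = \sum_i x i ord0 * Num.conj (x0 i ord0).
    apply: eq_bigr => i _; have [/uS->//|/notin_supp ->] := boolP (i \in S).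
    by rewrite conjC0 !mulr0.
  by apply: normF_sub_outer; rewrite E.
have card_u : (#|supp u :|: supp x0| <= k + s)%N.
  apply: leq_trans (leq_add cS Ts); apply: leq_trans (leq_card_setU S T).
  by rewrite subset_leq_card// subUset supp_restr subsetIr subsetUl.
set t := rnorm2 (quad_meas av (outer x - outer x0)).
have orth (y : 'cV[R[i]]_d) (A : {set 'I_d}) : y \in ys ->
    A \subset S :|: T -> forall i, restr A x i ord0 * y i ord0 = 0.
  move=> yys AST i; rewrite restrE; case: ifP => [iA|_]; last by rewrite mul0r.
  have /notin_supp -> : i \notin supp y; last by rewrite mulr0.
  apply/negP => /(subsetP (ysup y yys)).
  by rewrite inE (subsetP AST).
(* [S] and [T] are paired with the blocks separately: each pairing stays within [2 a k] columns,
   while the union could need [k + 2 s]. Recombining costs another [sqrt 2], whence the factor 2 in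
   [meas_cross]. *)
have cross (A : {set 'I_d}) : (#|A| <= k)%N || (#|A| <= s)%N -> A \subset S :|: T ->
    mean_meas av (sym_outer (restr A x) z) <= C * (Num.sqrt 2 * (normF (restr A x) * L)).
  move=> As AST; apply: (mean_meas_cross hRIP) => y yys.
    have sA : (#|supp (restr A x)| <= #|A|)%N by rewrite subset_leq_card// supp_restr subsetIr.
    have ysR : (#|supp y|)%:R <= a * k%:R by apply: le_trans sak; rewrite ler_nat yss.
    have AR : (#|A|)%:R <= a * k%:R.
      by case/orP: As => As; [apply: le_trans kak|apply: le_trans sak]; rewrite ler_nat.
    have sAR : (#|supp (restr A x)|)%:R <= a * k%:R by apply: le_trans AR; rewrite ler_nat.
    by rewrite natrD twoak lerD.
  by rewrite (normF_sym_outer_orth (orth y A yys AST)).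
have HE : outer x - outer x0 = H + outer z + sym_outer u z.
  rewrite {1}xE outerD /H; move: (sym_outer u z) => Z.
  by rewrite -!addrA; congr (_ + _); rewrite addrA addrC.
have meas_cross : mean_meas av (sym_outer u z) <= C * (2 * normF u * L).
  rewrite /u restrU// sym_outerC sym_outerDr -/z.
  apply: le_trans (mean_measD _ _ _) _; rewrite ![sym_outer z _]sym_outerC.
  apply: le_trans (lerD (cross S _ _) (cross T _ _)) _;
    rewrite ?cS ?Ts ?orbT ?subsetUl ?subsetUr//.
  rewrite -mulrDr -mulrDr -mulrDl ler_pM2l// mulrA -restrU// ler_wpM2r//.
  apply: le_trans (ler_wpM2l (sqrtr_ge0 _) (normF_restrU x ST)) _.
  by rewrite mulrA -expr2 [Num.sqrt 2 ^+ 2]sqr_sqrtr.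
have ssR : (s + s)%:R <= 2 * a * k%:R by rewrite natrD twoak lerD.
have meas_tail : mean_meas av (outer z) <= C * L ^+ 2 := mean_meas_blocks hRIP ssR yss.
have H1 : c * h <= t * (1 / Num.sqrt m%:R) + C * (2 * normF u * L) + C * L ^+ 2.
  have Hmeas : c * h <= mean_meas av H.
    apply: (hR _ _ _ _).1.
    - by apply: hermsymmxB; exact: hermsymmx_outer.
    - exact: rank_outerB.
    - apply: le_trans (_ : (k + s)%:R <= _); last by rewrite natrD twoak lerD.
      by rewrite ler_nat (leq_trans (norm02_outerB _ _)).
  apply: le_trans Hmeas _.
  have {1}-> : H = (outer x - outer x0) + - sym_outer u z + - outer z.
    by rewrite HE addrK addrK.
  apply: le_trans (mean_measD _ _ _) _; rewrite mean_measN; apply: lerD => //.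
  apply: le_trans (mean_measD _ _ _) _; rewrite mean_measN; apply: lerD => //.
  by rewrite mul1r; exact: rnorm1_le_rnorm2.
have zL : normF z <= L by exact: normF_sum_le.
have HF : normF (outer x - outer x0) <= h + 2 * normF u * L + L ^+ 2.
  rewrite HE addrAC; apply: le_trans (ler_normFD _ _) _; apply: lerD.
    apply: le_trans (ler_normFD _ _) _; rewrite lerD2l.
    apply: le_trans (normF_sym_outer_le _ _) _.
    by rewrite -mulrA ler_pM2l// ler_wpM2l.
  by rewrite normF_outer lerXn2r// nnegrE normF_ge0.
have hD : norm1 x0 - n0 <= Num.sqrt k%:R * normF (u - x0).
  rewrite x0N n0E; apply: le_trans (sum_normc_le_card _ _ _) _.
  by rewrite ler_wpM2r ?normF_ge0// ler_wsqrtr// ler_nat.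
have hh : norm1 x0 ^+ 2 - n0 ^+ 2 <= k%:R * h.
  rewrite x0N n0E; apply: le_trans (sqr_sum_normc_le_card _ _ _) _.
  by rewrite ler_wpM2r// ler_nat.
pose sa := Num.sqrt a; pose sk := Num.sqrt (k%:R : R); pose sm := Num.sqrt mu.
pose r := Num.sqrt (2 : R).
have sa0 : 0 < sa by rewrite sqrtr_gt0.
have sk0 : 0 < sk by rewrite sqrtr_gt0.
have sm0 : 0 < sm by rewrite sqrtr_gt0.
have r0 : 0 < r by rewrite sqrtr_gt0.
have aE : a = sa ^+ 2 by rewrite sqr_sqrtr ?ltW.
have kE : k%:R = sk ^+ 2 by rewrite sqr_sqrtr ?ltW.
have muE : mu = sm ^+ 2 by rewrite sqr_sqrtr ?ltW.
have rE : r ^+ 2 = 2 by rewrite sqr_sqrtr.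
have r75 : 7 / 5 <= r by exact: sqrt2_ge.
have sa1 : 1 <= sa by rewrite -sqrtr1 ler_wsqrtr.
have sk1 : 1 <= sk by rewrite -sqrtr1 ler_wsqrtr.
have HL : L <= r / (sa * sk) * l.
  (* From [a k <= 2 s] follows [1 / sqrt s <= sqrt 2 / sqrt (a k)]. *)
  apply: le_trans Lle _; rewrite -/l mulrC ler_wpM2r//.
  have s0 : 0 < s%:R :> R.
    by rewrite -(@pmulr_rgt0 _ 2)//; apply: lt_le_trans ak2s; rewrite mulr_gt0.
  rewrite -[_^-1]mul1r ler_pdivrMr ?sqrtr_gt0// mulrAC ler_pdivlMr ?mulr_gt0// mul1r.
  by rewrite -!sqrtrM// ?ler_wsqrtr// ltW.
(* The [eq_ind] terms restate [hh] and [hmin] with [k] and [mu] written as squares of [sk] and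
   [sm]. *)
have [HV HW] := tail_estimates rE r0 sa0 sk0 sm0 e0 h0 N00 n00 l0 L0 U0 xN hD
  (eq_ind _ (fun z => _ <= z * h) hh _ kE) UD UN HL (sqr_ge0 _)
  (eq_ind _ (fun z => z * _ + _ <= z * _ + _) hmin _ muE)
  (sqr_rnorm2_le (quad_meas av (outer x - outer x0)) w).
have p2E : sa^-1 ^+ 2 = a^-1 by rewrite aE exprVn.
have HP : (sa * sk * sm)^-1 * rnorm2 w <= rnorm2 w / sm.
  rewrite [leRHS]mulrC ler_wpM2r// invfM ler_piMl ?invr_ge0 ?(ltW sm0)//.
  by rewrite invf_le1 ?mulr_gt0// mulr_ege1.
have p1 : 0 < sa^-1 <= 1 by rewrite invr_gt0 sa0 invf_le1.
have gam0 : 0 < c - C * sa^-1 ^+ 2 - 4 * r * C * sa^-1 by rewrite p2E addrAC.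
have P0 : 0 < (sa * sk * sm)^-1 by rewrite invr_gt0 !mulr_gt0.
have := final_estimate C0 p1 P0 r75 e0 h0 N00 HP gam0 H1 HF HV HW.
rewrite /= p2E => /le_trans; apply; rewrite le_eqVlt; apply/orP; left; apply/eqP.
have sE : Num.sqrt (mu * a * k%:R) = sa * sk * sm.
  by rewrite !sqrtrM ?mulr_ge0 ?ltW// -/sa -/sk -/sm [sm * _]mulrC mulrAC.
have PE : (sa * sk * sm)^-1 ^+ 2 = (mu * a * k%:R)^-1.
  by rewrite -sE exprVn sqr_sqrtr// !mulr_ge0 ?ltW.
rewrite sE PE -/sa -/sm -/r [1 / a]mul1r.
set al := _ / (_ - _); set rm := 1 / Num.sqrt m%:R.
have [a_neq0 k_neq0] : a != 0 /\ k%:R != 0 :> R by rewrite !gt_eqF.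
have [mu_neq0 C_neq0] : mu != 0 /\ C != 0 by rewrite !gt_eqF.
move: (rnorm2 _) (norm1 x0) al rm a_neq0 k_neq0 mu_neq0 C_neq0.
move: (k%:R) (sa * sk * sm) => kR sP e N al rm a_neq0 k_neq0 mu_neq0 C_neq0.
by congr (_ + _ + _); field; rewrite ?a_neq0 ?k_neq0 ?mu_neq0 ?C_neq0.
Qed.

End AlignedBound.

Theorem theorem1p2 (R : realType) (d m k : nat) (hk : (0 < k)%N)
    (av : 'I_m -> 'cV[R[i]]_d) (a c C : R) (ha : 1 <= a)
    (hRIP : RIP (quad_meas av) 2 (2 * a * k%:R) c C)
    (hcC : 0 < c - 4 * Num.sqrt 2 * C / Num.sqrt a - C / a)
    (mu : R) (hmu : 0 < mu) :
  let alpha : R := (1 + 1 / a + 4 * Num.sqrt 2 / Num.sqrt a)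
                   / (c - C / a - 4 * Num.sqrt 2 * C / Num.sqrt a) in
  forall (x0 : 'cV[R[i]]_d) (w : 'cV[R]_m), sparse k x0 ->
  let b : 'cV[R]_m := quad_meas av (outer x0) + w in
  forall xs : 'cV[R[i]]_d,
  is_minimizer (fun X : 'M[R[i]]_d => psd X /\ \rank X = 1%N)
    (fun X : 'M[R[i]]_d =>
       mu * norm1 X + 1 / 2 * rnorm2 (quad_meas av X - b) ^+ 2)
    (outer xs) ->
  normF (outer xs - outer x0) <=
    (2 * C * alpha + 2) * (rnorm2 w / Num.sqrt (mu * a * k%:R))
      * (norm1 x0 + rnorm2 w / Num.sqrt mu)
    + rnorm2 w ^+ 2 / (2 * mu * a * k%:R)
    + alpha * (mu * a * k%:R / (2 * C))
      * (C * rnorm2 w / (mu * a * k%:R) + 1 / Num.sqrt m%:R) ^+ 2.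
Proof.
move=> alpha x0 w spx0 b xs /(minimizer_objective_le hmu).
(* The hypotheses and the conclusion see [x0] only through [outer x0] and the moduli of its entries,
   so an aligned copy may replace it. *)
have [y0 [yO yn yRe yIm]] := exists_aligned xs x0.
have yN : norm1 y0 = norm1 x0 by rewrite !norm1_colE; apply: eq_bigr => i _.
have spy0 : sparse k y0.
  rewrite /sparse (_ : [set i | _] = [set i | x0 i ord0 != 0])//.
  by apply/setP => i; rewrite !inE -!normc_eq0 yn.
rewrite -yN -yO => hmin.
exact: aligned_error_bound hRIP hcC spy0 hmin yRe yIm.
Qed.
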